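(* For $t>0$ small enough and singular points $(f(z_1,t_1),t_1)$, $(f(z_0,t_0),t_0)$ of the equation $$\frac{df(z,t)}{dt}=\frac{2}{f(z,t)-\sqrt[3]{t}},\qquad f(z,0)=z,\qquad \operatorname{Im} z\ge 0,$$ with $0<t_1<t_0<t$, the following inequalities hold: $$f_2(z_1,t)<f_2(z_0,t),\qquad f_1(z_0,t)<f_1(z_1,t).$$ Here ''$t>0$ small enough'' means that there is $T'>0$, independent of $t_0,t_1,z_0,z_1$, such that the inequalities hold whenever $0<t_1<t_0<t<T'$.
   Context: A point $(f(z_j,t_j),t_j)$ with $t_j>0$ is a singular point of the equation if $f(z_j,t_j)=\sqrt[3]{t_j}$. For such a singular point ($j=0,1$), the functions $f_1(z_j,t)$ and $f_2(z_j,t)$, $t\ge t_j$, are the two real branches of the solution through $(\sqrt[3]{t_j},t_j)$, which expand near $t_j$ in powers of $(t-t_j)^{1/2}$: they are continuous on $t\ge t_j$, satisfy $\frac{dy}{dt}=\frac{2}{y-\sqrt[3]{t}}$ for $t>t_j$ and $y(t_j)=\sqrt[3]{t_j}$, and as $t\to t_j+0$, $$f_1(z_j,t)=\sqrt[3]{t_j}+2\sqrt{t-t_j}+o(\sqrt{t-t_j}),\qquad f_2(z_j,t)=\sqrt[3]{t_j}-2\sqrt{t-t_j}+o(\sqrt{t-t_j}).$$ *)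

(* Defs.v *)
From Stdlib Require Import Reals.
From Coquelicot Require Import Coquelicot.
Open Scope R_scope.

(* [Rpower 0 (1/3)] is 1, not 0; the factor [sign t] makes this the real cube
   root on all of R. *)
Definition cbrt (t : R) : R := sign t * Rpower (Rabs t) (1 / 3).

(* Division is total, so that the equation is satisfied includes the
   requirement that its denominator does not vanish. At time 0 only the
   initial condition and continuity are imposed: for [z <> 0] the one-sided
   equation at 0 follows, and for [z = 0] it is singular. *)
Definition loewner_solution (y : R -> C) (z : C) (T : R) : Prop :=
  y 0 = z /\
  continuous_on (fun s : R => 0 <= s <= T) y /\
  (forall s : R, 0 < s < T ->
     y s <> RtoC (cbrt s) /\
     is_derive (K := R_AbsRing) (V := C_R_NormedModule) y s
       (RtoC 2 / (y s - RtoC (cbrt s)))%C).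

Definition singular_point (y : R -> C) (z : C) (tj : R) : Prop :=
  0 < tj /\ loewner_solution y z tj /\ y tj = RtoC (cbrt tj).

(* [is_domin F u v] means v = o(u) along F. *)
Definition real_branch (c : R) (g : R -> R) (tj : R) : Prop :=
  continuous_on (fun t : R => tj <= t) g /\
  (forall t : R, tj < t ->
     g t <> cbrt t /\ is_derive g t (2 / (g t - cbrt t))) /\
  g tj = cbrt tj /\
  is_domin (at_right tj) (fun t : R => sqrt (t - tj))
    (fun t : R => g t - (cbrt tj + c * sqrt (t - tj))).

Definition branch1 : (R -> R) -> R -> Prop := real_branch 2.
Definition branch2 : (R -> R) -> R -> Prop := real_branch (-2).

(* Main.v *)
Require Import Defs.
From Stdlib Require Import Reals Lra Psatz Ranalysis5.
From Coquelicot Require Import Coquelicot.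
Open Scope R_scope.

(** For [c = 2] or [-2] the expansion at the singular time puts the branch
    strictly on the side of [cbrt] given by the sign of [c], where it stays. So
    when the later branch starts, on [cbrt], the earlier one is already strictly
    outside it. The difference [d] of the two branches satisfies the linear
    equation [d' = -2 d / ((g - cbrt) (h - cbrt))], hence keeps its sign. This
    holds for all times, so any [T'] will do. *)

Lemma linear_ode_pos (d q : R -> R) (a b : R) :
  a < b ->
  (forall s, a <= s <= b -> is_derive d s (- q s * d s)) ->
  (forall s, a <= s <= b -> continuity_pt q s) ->
  0 < d a -> 0 < d b.
Proof.
intros Hab Hd Hq Hda.
destruct (continuity_ab_maj q a b) as [m [Hm _]]; [lra | exact Hq |].
(* The maximum [q m] of [q] makes this energy nondecreasing, so [d] never vanishes. *)
pose (E := fun s => d s * d s * exp (2 * q m * s)).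
assert (HE : forall s, a <= s <= b ->
  is_derive E s (2 * (q m - q s) * (d s * d s) * exp (2 * q m * s))).
{ intros s Hs; unfold E.
  assert (H := Hd s Hs).
  auto_derive.
  - repeat split; exists (- q s * d s); exact H.
  - replace (Derive (fun x : R => d x) s) with (- q s * d s).
    + ring.
    + symmetry; apply is_derive_unique; exact H. }
(* At a zero [x] of [d] the energy vanishes, while the mean value theorem on [[a, x]] gives
   [E x >= E a > 0]. *)
assert (Hnz : forall x, a < x <= b -> d x <> 0).
{ intros x Hx H0.
  destruct (MVT_gen E a x
    (fun s => 2 * (q m - q s) * (d s * d s) * exp (2 * q m * s)))
    as [y [Hy HEy]].
  - intros s; rewrite Rmin_left, Rmax_right by lra; intros Hs; apply HE; lra.
  - intros s; rewrite Rmin_left, Rmax_right by lra; intros Hs.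
    apply derivable_continuous_pt.
    eexists; apply is_derive_Reals, HE; lra.
  - rewrite Rmin_left, Rmax_right in Hy by lra.
    assert (Hqy : q y <= q m) by (apply Hm; lra).
    assert (Hpos : 0 < E a).
    { unfold E; apply Rmult_lt_0_compat; [nra | apply exp_pos]. }
    assert (Ex : E x = 0) by (unfold E; rewrite H0; ring).
    rewrite Ex in HEy.
    assert (0 <= 2 * (q m - q y) * (d y * d y) * exp (2 * q m * y) * (x - a)).
    { assert (H := exp_pos (2 * q m * y)).
      apply Rmult_le_pos; [apply Rmult_le_pos; [apply Rmult_le_pos |] |]; nra. }
    lra. }
destruct (Rlt_le_dec 0 (d b)) as [|Hb]; [assumption | exfalso].
assert (Hdb : d b < 0) by (assert (H := Hnz b ltac:(lra)); lra).
(* [IVT_interv] wants a function going from negative to positive, hence [- d]. The zero found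
   contradicts [Hnz]. *)
destruct (IVT_interv (fun s => - d s) a b) as [x [Hx Hx0]]; try lra.
- intros s Hs; apply continuity_pt_opp, derivable_continuous_pt.
  eexists; apply is_derive_Reals, Hd; lra.
- assert (x <> a) by (intros H; rewrite H in Hx0; lra).
  apply (Hnz x); lra.
Qed.

Lemma ex_derive_cbrt (t : R) : 0 < t -> ex_derive cbrt t.
Proof.
intros Ht.
apply ex_derive_ext_loc with (fun s => Rpower s (1 / 3)).
- apply (filter_imp (fun s => 0 < s)).
  + intros s Hs; unfold cbrt.
    rewrite sign_eq_1, Rabs_pos_eq by lra; symmetry; apply Rmult_1_l.
  + exact (open_gt 0 t Ht).
- unfold Rpower; auto_derive; exact Ht.
Qed.

Lemma continuity_pt_cbrt (t : R) : 0 < t -> continuity_pt cbrt t.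
Proof.
intros Ht; apply continuity_pt_filterlim.
exact (ex_derive_continuous cbrt t (ex_derive_cbrt t Ht)).
Qed.

Lemma real_branch_continuity_pt (c : R) (g : R -> R) (tj t : R) :
  real_branch c g tj -> tj < t -> continuity_pt g t.
Proof.
intros (_ & Hode & _) Ht.
apply derivable_continuous_pt.
eexists; apply is_derive_Reals, Hode, Ht.
Qed.

(** A differentiable function varies by [O(s - x)], which is [o(sqrt (s - x))]. Applied to [cbrt],
    this lets the square-root term of a branch be compared with the moving [cbrt s] instead of the
    fixed [cbrt tj]. *)
Lemma ex_derive_littleo_sqrt (h : R -> R) (x eps : R) :
  0 < eps -> ex_derive h x ->
  at_right x (fun s => Rabs (h s - h x) <= eps * sqrt (s - x)).
Proof.
intros Heps [l Hl].
apply is_derive_Reals in Hl.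
destruct (Hl 1 Rlt_0_1) as [del Hdel].
set (L := Rabs l + 1).
assert (HL : 0 < L) by (unfold L; assert (H := Rabs_pos l); lra).
(* [L] bounds the difference quotient, and [s - x < r * r] forces [sqrt (s - x) <= r]; hence
   [L * (s - x) <= eps * sqrt (s - x)]. *)
set (r := eps / L).
assert (Hr : 0 < r) by (apply Rdiv_lt_0_compat; assumption).
assert (Hmin : 0 < Rmin del (r * r)).
{ apply Rmin_pos; [apply cond_pos | nra]. }
exists (mkposreal _ Hmin).
intros s Hs Hxs; simpl in s.
assert (Hs' : Rabs (s - x) < Rmin del (r * r)) by exact Hs.
rewrite Rabs_pos_eq in Hs' by lra.
assert (Hs1 := Rmin_l del (r * r)).
assert (Hs2 := Rmin_r del (r * r)).
assert (Hq : Rabs ((h (x + (s - x)) - h x) / (s - x) - l) < 1).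
{ apply Hdel; [lra | rewrite Rabs_pos_eq; lra]. }
rewrite Rplus_minus in Hq.
set (Q := (h s - h x) / (s - x)) in Hq.
assert (HQ : Rabs Q <= L).
{ replace Q with ((Q - l) + l) by ring.
  assert (H := Rabs_triang (Q - l) l); unfold L; lra. }
replace (h s - h x) with (Q * (s - x)) by (unfold Q; field; lra).
rewrite Rabs_mult, (Rabs_pos_eq (s - x)) by lra.
set (w := sqrt (s - x)).
assert (Hw : 0 < w) by (apply sqrt_lt_R0; lra).
assert (Hww : s - x = w * w) by (symmetry; apply sqrt_sqrt; lra).
assert (Hwr : w <= r) by nra.
assert (HLw : L * w <= eps).
{ replace eps with (L * r) by (unfold r; field; lra).
  apply Rmult_le_compat_l; lra. }
rewrite Hww.
apply Rle_trans with (L * (w * w)); nra.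
Qed.

(** Just after [tj] the term [c * sqrt (s - tj)] dominates and fixes the sign. Later the sign cannot
    change: the equation keeps [g] off [cbrt], and a change would force a crossing by the
    intermediate value theorem. *)
Lemma real_branch_side (c : R) (g : R -> R) (tj t : R) :
  c <> 0 -> 0 < tj -> real_branch c g tj -> tj < t -> 0 < c * (g t - cbrt t).
Proof.
intros Hc Htj Hg Ht.
assert (Hcont := fun s => real_branch_continuity_pt c g tj s Hg).
destruct Hg as (_ & Hode & _ & Hdom).
assert (HC : 0 < Rabs c) by (apply Rabs_pos_lt; exact Hc).
(* The errors from the expansion of [g] and from the variation of [cbrt] are each at most a quarter
   of [Rabs c * sqrt (s - tj)], so at least half of the main term survives. *)
assert (He : 0 < Rabs c / 4) by lra.
assert (Hnear : at_right tj (fun s => 0 < c * (g s - cbrt s))).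
{ assert (H1 := Hdom (mkposreal _ He)).
  assert (H2 := ex_derive_littleo_sqrt cbrt tj _ He (ex_derive_cbrt tj Htj)).
  assert (H3 : at_right tj (fun s => tj < s)).
  { exists (mkposreal 1 Rlt_0_1); intros s _ Hs; exact Hs. }
  generalize (filter_and _ _ H1 (filter_and _ _ H2 H3)).
  apply filter_imp; intros s [K1 [K2 K3]].
  change (Rabs (g s - (cbrt tj + c * sqrt (s - tj)))
          <= Rabs c / 4 * Rabs (sqrt (s - tj))) in K1.
  assert (Hw : 0 < sqrt (s - tj)) by (apply sqrt_lt_R0; lra).
  set (w := sqrt (s - tj)) in *.
  rewrite (Rabs_pos_eq w) in K1 by lra.
  apply Rabs_le_between in K1; apply Rabs_le_between in K2.
  assert (0 < Rabs c * w) by nra.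
  unfold Rabs in *; destruct (Rcase_abs c); nra. }
destruct Hnear as [eps Heps].
set (a := tj + Rmin (eps / 2) ((t - tj) / 2)).
assert (He0 := cond_pos eps).
assert (Ha1 := Rmin_l (eps / 2) ((t - tj) / 2)).
assert (Ha2 := Rmin_r (eps / 2) ((t - tj) / 2)).
assert (Ha3 : 0 < Rmin (eps / 2) ((t - tj) / 2)) by (apply Rmin_pos; lra).
assert (Hpa : 0 < c * (g a - cbrt a)).
{ apply Heps; [|unfold a; lra].
  change (Rabs (a - tj) < eps).
  unfold a; rewrite Rabs_pos_eq; lra. }
destruct (Rlt_le_dec 0 (c * (g t - cbrt t))) as [|Hle]; [assumption | exfalso].
assert (Hneq : forall s, tj < s -> c * (g s - cbrt s) <> 0).
{ intros s Hs; apply Rmult_integral_contrapositive_currified; [exact Hc|].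
  apply Rminus_eq_contra, Hode, Hs. }
assert (Hnt := Hneq t Ht).
destruct (IVT_interv (fun s => - (c * (g s - cbrt s))) a t) as [x [Hx Hx0]];
  try (unfold a in *; lra).
- intros s Hs.
  assert (tj < s) by (unfold a in *; lra).
  apply continuity_pt_opp, continuity_pt_scal.
  apply continuity_pt_minus; [apply Hcont | apply continuity_pt_cbrt]; lra.
- apply (Hneq x); unfold a in *; lra.
Qed.

(** This includes [m = tj], where the equation is not imposed and continuity cannot come from a
    derivative. *)
Lemma real_branch_right_continuous (c : R) (g : R -> R) (tj m : R) :
  real_branch c g tj -> tj <= m -> filterlim g (at_right m) (locally (g m)).
Proof.
intros (Hcont & _) Hm P HP.
generalize (Hcont m Hm P HP); apply (filter_imp (F := locally m)).
intros s Hs Hms.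
apply Hs; lra.
Qed.

(** If a branch starts at [m], it lies on [cbrt] there and the coefficient of the linear equation is
    singular. Right continuity carries the strict inequality to some [m + del], from which the
    coefficient is continuous up to [t]. *)
Lemma real_branch_lt (c c' : R) (g h : R -> R) (tg th m t : R) :
  0 < m -> real_branch c g tg -> real_branch c' h th ->
  tg <= m -> th <= m -> m < t -> h m < g m -> h t < g t.
Proof.
intros Hm0 Hg Hh Htg Hth Ht Hm.
assert (Hnear : at_right m (fun s => h s < g s)).
(* The midpoint separates the two branches on a right neighbourhood of [m]. *)
{ set (y := (h m + g m) / 2).
  assert (H1 := real_branch_right_continuous c g tg m Hg Htg _
    (open_gt y (g m) ltac:(unfold y; lra))).
  assert (H2 := real_branch_right_continuous c' h th m Hh Hth _
    (open_lt y (h m) ltac:(unfold y; lra))).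
  unfold filtermap in H1, H2.
  generalize (filter_and _ _ H1 H2); apply filter_imp; intros s [K1 K2].
  exact (Rlt_trans _ _ _ K2 K1). }
destruct Hnear as [eps Heps].
assert (He0 := cond_pos eps).
set (del := Rmin (eps / 2) ((t - m) / 2)).
assert (Ha1 : del <= eps / 2) by apply Rmin_l.
assert (Ha2 : del <= (t - m) / 2) by apply Rmin_r.
assert (Ha3 : 0 < del) by (apply Rmin_pos; lra).
assert (Ha : h (m + del) < g (m + del)).
{ apply Heps; [|lra].
  change (Rabs (m + del - m) < eps).
  rewrite Rabs_pos_eq; lra. }
assert (Hcg := fun s => real_branch_continuity_pt c g tg s Hg).
assert (Hch := fun s => real_branch_continuity_pt c' h th s Hh).
destruct Hg as (_ & Hog & _); destruct Hh as (_ & Hoh & _).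
enough (0 < g t - h t) by lra.
apply (linear_ode_pos (fun s => g s - h s)
  (fun s => 2 / ((g s - cbrt s) * (h s - cbrt s))) (m + del) t); try lra.
- intros s Hs.
  destruct (Hog s) as [Hgs Hdg]; [lra|].
  destruct (Hoh s) as [Hhs Hdh]; [lra|].
  evar_last.
  + exact (is_derive_minus g h s _ _ Hdg Hdh).
  + change (2 / (g s - cbrt s) - 2 / (h s - cbrt s) =
      - (2 / ((g s - cbrt s) * (h s - cbrt s))) * (g s - h s)).
    field; lra.
- intros s Hs.
  assert (Hgs := proj1 (Hog s ltac:(lra))).
  assert (Hhs := proj1 (Hoh s ltac:(lra))).
  assert (continuity_pt cbrt s) by (apply continuity_pt_cbrt; lra).
  apply continuity_pt_div.
  + apply continuity_pt_const; intros x y; reflexivity.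
  + apply continuity_pt_mult; apply continuity_pt_minus; auto;
      [apply Hcg | apply Hch]; lra.
  + apply Rmult_integral_contrapositive_currified; lra.
Qed.

Theorem lemma3 :
  exists T' : R, 0 < T' /\
    forall (f : C -> R -> C) (f1 f2 : C -> R -> R) (z0 z1 : C) (t0 t1 t : R),
      0 <= Im z0 -> 0 <= Im z1 ->
      singular_point (f z0) z0 t0 -> singular_point (f z1) z1 t1 ->
      branch1 (f1 z0) t0 -> branch2 (f2 z0) t0 ->
      branch1 (f1 z1) t1 -> branch2 (f2 z1) t1 ->
      0 < t1 -> t1 < t0 -> t0 < t -> t < T' ->
      f2 z1 t < f2 z0 t /\ f1 z0 t < f1 z1 t.
Proof.
exists 1; split; [lra|].
intros f f1 f2 z0 z1 t0 t1 t _ _ _ _ H10 H20 H11 H21 Ht1 Ht10 Ht0 _.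
assert (E1 : f1 z0 t0 = cbrt t0) by apply H10.
assert (E2 : f2 z0 t0 = cbrt t0) by apply H20.
assert (S1 := real_branch_side 2 (f1 z1) t1 t0 ltac:(lra) Ht1 H11 Ht10).
assert (S2 := real_branch_side (-2) (f2 z1) t1 t0 ltac:(lra) Ht1 H21 Ht10).
split.
(* The comparison starts at [t0]. Below [cbrt] the later branch is the larger one, above it the
   earlier one, so the roles are exchanged between the two cases. *)
- apply (real_branch_lt (-2) (-2) (f2 z0) (f2 z1) t0 t1 t0); trivial; lra.
- apply (real_branch_lt 2 2 (f1 z1) (f1 z0) t1 t0 t0); trivial; lra.
Qed.
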